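(* Let $n\ge 2$, let $G=\mathbb{R}^n\setminus\{0\}$, let $x\in G$ and let $M>0$. Then: (1) the $j$-ball $B_j(x,M)$ of $G$ is convex if and only if $M\in(0,\log 2]$; (2) the $j$-ball $B_j(x,M)$ of $G$ is strictly convex if and only if $M\in(0,\log 2)$.
   Context: For a domain $G\subsetneq\mathbb{R}^n$, $n\ge 2$, and $x\in G$ let $d(x)$ denote the Euclidean distance from $x$ to $\partial G$ (so $d(x)=|x|$ when $G=\mathbb{R}^n\setminus\{0\}$). The $j$-metric on $G$ is $$j_G(x,y)=\log\left(1+\frac{|x-y|}{\min\{d(x),d(y)\}}\right),\qquad x,y\in G.$$ For $x\in G$ and $M>0$ the $j$-ball is $B_j(x,M)=\{y\in G: j_G(x,y)<M\}$. *)

(* Defs.v *)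
From HB Require Import structures.
From mathcomp Require Import all_boot all_order all_algebra.
From mathcomp Require Import all_classical all_reals all_analysis.

Set Implicit Arguments.
Unset Strict Implicit.
Unset Printing Implicit Defensive.

Import Order.TTheory GRing.Theory Num.Theory numFieldNormedType.Exports.
Local Open Scope classical_set_scope.
Local Open Scope ring_scope.

(* The norm `|x| that the library puts on 'rV[R]_n is the sup norm. It induces
   the same topology as the Euclidean norm, so [closure] and [interior] below
   are the usual ones, but distances must be measured with [enorm]. *)
Definition enorm (R : realType) (n : nat) (x : 'rV[R]_n) : R :=
  Num.sqrt (\sum_(i < n) x ord0 i ^+ 2).

Definition boundary (T : topologicalType) (A : set T) : set T :=
  closure A `\` interior A.

(* [inf] is the real infimum, with the junk value 0 on the empty set; the
   boundary is nonempty whenever G is a nonempty proper subset. *)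
Definition bdist (R : realType) (n : nat) (G : set 'rV[R]_n) (x : 'rV[R]_n) : R :=
  inf [set enorm (x - z) | z in boundary G].

Definition jmetric (R : realType) (n : nat) (G : set 'rV[R]_n)
    (x y : 'rV[R]_n) : R :=
  ln (1 + enorm (x - y) / Num.min (bdist G x) (bdist G y)).

Definition jball (R : realType) (n : nat) (G : set 'rV[R]_n)
    (x : 'rV[R]_n) (M : R) : set 'rV[R]_n :=
  [set y | G y /\ jmetric G x y < M].

Definition punctured_space (R : realType) (n : nat) : set 'rV[R]_n :=
  ~` [set 0].
Arguments punctured_space : clear implicits.

(* Endpoints range over the closure: with endpoints in A only, every open
   convex set would qualify. *)
Definition strictly_convex_set (R : realType) (n : nat) (A : set 'rV[R]_n) :=
  forall x y : 'rV[R]_n, closure A x -> closure A y -> x <> y ->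
  forall t : R, 0 < t < 1 -> interior A (t *: x + (1 - t) *: y).

(* Main.v *)
Require Import Defs.
From mathcomp Require Import all_boot all_order all_algebra.
From mathcomp Require Import all_classical all_reals all_analysis.
From mathcomp Require Import ring lra.
Import Order.TTheory GRing.Theory Num.Theory numFieldNormedType.Exports.
Local Open Scope classical_set_scope.
Local Open Scope ring_scope.

(** Put c = exp M - 1, so that M <= ln 2 means c <= 1.  The only boundary point
    of the punctured space is the origin, hence j(x, y) < M says that
    |x - y| < c min(|x|, |y|), and the j-ball is the intersection of two sets:
    the round ball |x - y| < c |x|, and the side |x - y| < c |y| of an
    Apollonius sphere, which is a ball for c < 1, a half-space for c = 1 and the
    exterior of a ball for c > 1.

    Both are sublevel sets of a function of the form
    f_k(y) = |x - y|^2 - k |y|^2, with k = 0 and k = c^2.  This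
    avoids completing the square in each of the three cases: along a segment
    [y, z] Stewart's theorem gives
      f_k(t y + (1 - t) z)
        = t f_k(y) + (1 - t) f_k(z) - (1 - k) t (1 - t) |y - z|^2
    ([apollonius_conv]).  So sublevel sets are convex as soon as k <= 1, and for
    k < 1 even a segment whose endpoints only satisfy the weak inequality has
    its relative interior in the open sublevel set, which is strict convexity.

    For c >= 1 the obstruction sits at the apex p = x / (c + 1), where the
    Apollonius sphere crosses the segment from the origin to x; it satisfies
    |x - p| = c |p|, so it lies outside the j-ball ([apex_notin]).  Take v
    orthogonal to x with 0 < |v| <= |x|, which is possible because n >= 2; then
    p is the midpoint of p + v/2 and p - v/2.  If c > 1, both ends lie in the
    j-ball, since the sphere bends away from them, and the ball is not convex.
    If c = 1, the sphere is a hyperplane and the two ends lie on it; they are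
    limits of points of the j-ball, obtained by moving them in the direction
    of x, so the ball is not strictly convex. *)

(** * The squared Euclidean norm *)

Definition sqnorm {R : realType} {n : nat} (u : 'rV[R]_n) : R :=
  \sum_(i < n) u ord0 i ^+ 2.

Section SquaredNorm.
Context {R : realType} {n : nat}.
Implicit Types (u v x y : 'rV[R]_n) (s t : R).

Lemma sqnorm_ge0 u : 0 <= sqnorm u.
Proof. by apply: sumr_ge0 => i _; exact: sqr_ge0. Qed.

Lemma sqnorm_eq0 u : sqnorm u = 0 -> u = 0.
Proof.
move/eqP; rewrite /sqnorm psumr_eq0; last by move=> i _; exact: sqr_ge0.
move=> /allP u0; apply/rowP => i; rewrite mxE; apply/eqP.
by rewrite -sqrf_eq0; apply: u0; rewrite mem_index_enum.
Qed.

Lemma sqnorm_gt0 u : u <> 0 -> 0 < sqnorm u.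
Proof.
move=> u0; rewrite lt_neqAle sqnorm_ge0 andbT eq_sym.
by apply/eqP => /sqnorm_eq0.
Qed.

Lemma sqnormZ s u : sqnorm (s *: u) = s ^+ 2 * sqnorm u.
Proof.
rewrite /sqnorm mulr_sumr; apply: eq_bigr => i _.
by rewrite mxE exprMn.
Qed.

Lemma enorm_ltM (c : R) u v : 0 <= c ->
  (enorm u < c * enorm v) = (sqnorm u < c ^+ 2 * sqnorm v).
Proof.
move=> c0.
rewrite -[LHS](@ltr_pXn2r _ 2) ?nnegrE ?mulr_ge0 ?sqrtr_ge0//.
by rewrite exprMn /enorm !sqr_sqrtr ?sqnorm_ge0.
Qed.

(** Stewart's theorem; the defect term is what makes the square of the norm
    strictly convex. *)
Lemma sqnorm_conv t u v :
  sqnorm (t *: u + (1 - t) *: v) =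
  t * sqnorm u + (1 - t) * sqnorm v - t * (1 - t) * sqnorm (u - v).
Proof.
rewrite /sqnorm !mulr_sumr -big_split -sumrB /=.
by apply: eq_bigr => i _; rewrite !mxE; ring.
Qed.

Lemma sqnorm_continuous : continuous (@sqnorm R n).
Proof.
apply: continuous_big => [|i _ z]; first exact: add_continuous.
have zi : {for z, continuous (fun u : 'rV[R]_n => u ord0 i)}.
  exact: coord_continuous.
exact: continuous_comp zi (@exprn_continuous R 2 _).
Qed.

(** This is where the dimension matters: in the line there is no
    nonzero vector orthogonal to a nonzero [x].  Orthogonality is expressed by
    Pythagoras's theorem, which is the form in which it is used. *)
Lemma exists_orthogonal x : (2 <= n)%N -> x <> 0 ->
  exists v, [/\ 0 < sqnorm v, sqnorm v <= sqnorm x &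
    forall s t, sqnorm (s *: x + t *: v) =
      s ^+ 2 * sqnorm x + t ^+ 2 * sqnorm v].
Proof.
move=> n2 x0.
have [i xi0] : exists i, x ord0 i != 0.
  apply: contrapT => /forallNP xN; apply: x0; apply/rowP => i.
  by rewrite mxE; apply/eqP/negPn/negP; exact: xN.
have [j ji] : exists j : 'I_n, j != i.
  have : (0 < #|predC1 i|)%N by rewrite cardC1 card_ord -subn1 subn_gt0.
  by move=> /card_gt0P[j]; rewrite !inE; exists j.
(* The projection of [x] to the (i, j)-plane, rotated by a right angle. *)
pose v : 'rV[R]_n := \row_k
  (if k == i then x ord0 j else if k == j then - x ord0 i else 0).
have vk k : k != i -> k != j -> v ord0 k = 0.
  by rewrite mxE => /negbTE -> /negbTE ->.
pose r := \sum_(k < n | (k != i) && (k != j)) x ord0 k ^+ 2.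
have split2 u : sqnorm u = u ord0 i ^+ 2 + (u ord0 j ^+ 2 +
    \sum_(k < n | (k != i) && (k != j)) u ord0 k ^+ 2).
  by rewrite /sqnorm (bigD1 i)//= (bigD1 j).
have r0 : 0 <= r by apply: sumr_ge0 => k _; exact: sqr_ge0.
have xE : sqnorm x = x ord0 i ^+ 2 + (x ord0 j ^+ 2 + r) by exact: split2.
have combE s t : sqnorm (s *: x + t *: v) =
    (s * x ord0 i + t * x ord0 j) ^+ 2 +
    ((s * x ord0 j - t * x ord0 i) ^+ 2 + s ^+ 2 * r).
  rewrite split2 !mxE eqxx (negbTE ji) eqxx mulrN mulr_sumr.
  congr (_ + (_ + _)); apply: eq_bigr => k /andP[ki kj].
  by rewrite mxE [X in _ + X]mxE vk// mulr0 addr0 mxE exprMn.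
have vE : sqnorm v = x ord0 i ^+ 2 + x ord0 j ^+ 2.
  have := combE 0 1; rewrite scale0r add0r scale1r => ->; ring.
exists v; split.
- by rewrite vE ltr_pwDl ?sqr_ge0// exprn_even_gt0.
- by rewrite vE xE addrA lerDl.
- by move=> s t; rewrite combE vE xE; ring.
Qed.

End SquaredNorm.

(** * The j-ball of the punctured space *)

Section PuncturedSpace.
Context {R : realType} {n : nat}.
Implicit Types (x y : 'rV[R]_n).

Lemma boundary_punctured : (0 < n)%N ->
  boundary (punctured_space R n) = [set 0].
Proof.
move=> n0.
have int0 : ([set 0 : 'rV[R]_n])° = set0.
  rewrite -subset0 => z z0.
  have z_eq0 : z = 0 by exact: interior_subset z0.
  move: z0; rewrite z_eq0 => /nbhs_ballP[e /= e0 be].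
  have /be : ball (0 : 'rV[R]_n) e (const_mx (e / 2)).
    split=> // i j; rewrite !mxE /ball /= sub0r normrN gtr0_norm; lra.
  move=> /rowP/(_ (Ordinal n0)); rewrite !mxE; lra.
rewrite /boundary /punctured_space closure_setC int0 setC0 interiorC.
have closed0 : closed [set 0 : 'rV[R]_n].
  apply: accessible_closed_set1; apply: hausdorff_accessible.
  exact: norm_hausdorff.
by rewrite setTD setCK -(proj1 (closure_id _) closed0).
Qed.

Lemma bdist_punctured x : (0 < n)%N -> bdist (punctured_space R n) x = enorm x.
Proof.
by move=> n0; rewrite /bdist boundary_punctured// image_set1 subr0 inf1.
Qed.

Lemma enorm_gt0 x : x <> 0 -> 0 < enorm x.
Proof. by move=> /sqnorm_gt0 x0; rewrite /enorm sqrtr_gt0. Qed.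

(** The minimum in the metric turns the ball into an intersection of a round
    ball with one side of the Apollonius sphere of ratio [expR M - 1] with foci
    [x] and the origin. *)
Lemma jball_punctured x M : (0 < n)%N -> x <> 0 -> 0 < M ->
  let c := expR M - 1 in
  jball (punctured_space R n) x M =
  [set y | sqnorm (x - y) < c ^+ 2 * sqnorm x] `&`
  [set y | sqnorm (x - y) < c ^+ 2 * sqnorm y].
Proof.
move=> n0 x0 M0 c.
have c0 : 0 < c by rewrite subr_gt0 expR_gt1.
have jE y : y <> 0 -> (jmetric (punctured_space R n) x y < M) =
    (sqnorm (x - y) < c ^+ 2 * sqnorm x) &&
    (sqnorm (x - y) < c ^+ 2 * sqnorm y).
  move=> y0; rewrite -!enorm_ltM ?ltW// /jmetric !bdist_punctured//.
  set m := Num.min _ _.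
  have m0 : 0 < m by rewrite lt_min !enorm_gt0.
  have r0 : 0 <= enorm (x - y) / m by rewrite divr_ge0 ?sqrtr_ge0 ?ltW.
  rewrite -[M in LHS]expRK ltr_ln ?posrE ?expR_gt0 ?ltr_pwDl//.
  rewrite -ltrBrDl -/c ltr_pdivrMr// /m /Num.min.
  case: ifPn => [xy|]; last rewrite -leNgt => yx.
    rewrite andb_idr// => /lt_trans; apply; by rewrite ltr_pM2l.
  by rewrite andb_idl// => /lt_le_trans; apply; rewrite ler_pM2l.
apply/seteqP; split=> y /=.
  by case=> y0; rewrite jE// => /andP.
move=> xy; have y0 : y <> 0.
  move=> y0; move: (xy.2); rewrite y0 {2}/sqnorm big1 ?mulr0 => [|i _].
    by rewrite ltNge sqnorm_ge0.
  by rewrite mxE expr0n.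
by split=> //; rewrite jE//; apply/andP.
Qed.

End PuncturedSpace.

(** * Sublevel sets of the Apollonius function *)

(** Its zero set is the Apollonius sphere of the points at distance ratio
    [Num.sqrt k] from [x] and the origin; for [k = 0] it is the squared distance
    to [x], so that both conditions defining the j-ball have the same shape. *)
Definition apollonius {R : realType} {n : nat} (x : 'rV[R]_n) (k : R)
    (y : 'rV[R]_n) : R := sqnorm (x - y) - k * sqnorm y.

Section Apollonius.
Context {R : realType} {n : nat}.
Implicit Types (x y z : 'rV[R]_n) (k l t : R).

(** Stewart's theorem is used for [x - y] and for [y]: both defect terms involve
    the chord [y - z], so they combine into the factor [1 - k]. *)
Lemma apollonius_conv x k t y z :
  apollonius x k (t *: y + (1 - t) *: z) =
  t * apollonius x k y + (1 - t) * apollonius x k z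
    - (1 - k) * (t * (1 - t) * sqnorm (y - z)).
Proof.
rewrite /apollonius.
have -> : x - (t *: y + (1 - t) *: z) = t *: (x - y) + (1 - t) *: (x - z).
  by apply/rowP => i; rewrite !mxE; ring.
have zy : sqnorm (x - y - (x - z)) = sqnorm (y - z).
  by apply: eq_bigr => i _; rewrite !mxE; ring.
by rewrite !sqnorm_conv zy; ring.
Qed.

Lemma apollonius_conv_lt x k l t y z : k <= 1 -> 0 < t < 1 ->
  apollonius x k y < l -> apollonius x k z < l ->
  apollonius x k (t *: y + (1 - t) *: z) < l.
Proof.
move=> k1 /andP[t0 t1] yl zl; rewrite apollonius_conv.
have d0 : 0 <= (1 - k) * (t * (1 - t) * sqnorm (y - z)).
  by rewrite !mulr_ge0 ?sqnorm_ge0 ?subr_ge0 ?(ltW t0) ?(ltW t1).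
nra.
Qed.

(** Here the endpoints may lie on the boundary of the sublevel set: the defect
    term, positive for [k < 1], pushes the segment inside. *)
Lemma apollonius_conv_lt_strict x k l t y z : k < 1 -> 0 < t < 1 -> y <> z ->
  apollonius x k y <= l -> apollonius x k z <= l ->
  apollonius x k (t *: y + (1 - t) *: z) < l.
Proof.
move=> k1 /andP[t0 t1] yz yl zl; rewrite apollonius_conv.
have yz0 : 0 < sqnorm (y - z).
  by apply: sqnorm_gt0 => /eqP; rewrite subr_eq0 => /eqP.
have d0 : 0 < (1 - k) * (t * (1 - t) * sqnorm (y - z)).
  by rewrite !mulr_gt0 // subr_gt0.
clear yz; nra.
Qed.

Lemma apollonius_continuous x k : continuous (apollonius x k).
Proof.
move=> y.
have xy : {for y, continuous (fun w : 'rV[R]_n => x - w)}.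
  by apply: continuousB; [exact: cst_continuous | exact: cvg_id].
have dist_y : {for y, continuous (fun w : 'rV[R]_n => sqnorm (x - w))}.
  exact: continuous_comp xy (@sqnorm_continuous _ _ _).
apply: (cvgB dist_y); apply: cvgM; first exact: cvg_cst.
exact: sqnorm_continuous.
Qed.

Lemma open_apollonius_lt x k l : open [set y | apollonius x k y < l].
Proof.
apply: (@open_comp _ _ (apollonius x k) [set r | r < l]); last exact: open_lt.
by move=> y _; exact: apollonius_continuous.
Qed.

Lemma closed_apollonius_le x k l : closed [set y | apollonius x k y <= l].
Proof.
apply: (@preimage_closed _ _ (apollonius x k) [set r | r <= l]).
  by move=> y _; exact: apollonius_continuous.
exact: closed_le.
Qed.

End Apollonius.

(** * Convexity of the intersection *)

Definition apollonius_ball {R : realType} {n : nat} (x : 'rV[R]_n) (c : R) :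
    set 'rV[R]_n :=
  [set y | apollonius x 0 y < c ^+ 2 * sqnorm x] `&`
  [set y | apollonius x (c ^+ 2) y < 0].

Lemma jball_apollonius {R : realType} {n : nat} (x : 'rV[R]_n) (M : R) :
  (0 < n)%N -> x <> 0 -> 0 < M ->
  jball (punctured_space R n) x M = apollonius_ball x (expR M - 1).
Proof.
move=> n0 x0 M0; rewrite jball_punctured//.
by rewrite /apollonius_ball /apollonius; apply/seteqP; split=> y /= [];
  rewrite mul0r subr0 subr_lt0.
Qed.

Lemma convex_setP (R : realType) (n : nat) (A : set 'rV[R]_n) :
  convex_set A <->
  forall y z t, A y -> A z -> 0 < t < 1 -> A (t *: y + (1 - t) *: z).
Proof.
rewrite convex_setW; split=> [cA y z t Ay Az /andP[t0 t1]|cA y z yA zA t t0 t1].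
  exact: set_mem (cA y z (mem_set Ay) (mem_set Az)
    (Itv01 (ltW t0) (ltW t1)) t0 t1).
apply: mem_set; apply: cA; [exact: set_mem yA | exact: set_mem zA | exact/andP].
Qed.

(** Strict convexity speaks of endpoints in the closure, so in particular of
    endpoints in the set. *)
Lemma strictly_convex_convex {R : realType} {n : nat} (A : set 'rV[R]_n) :
  strictly_convex_set A -> convex_set A.
Proof.
move=> sA; apply/convex_setP => y z t Ay Az t01.
have [->|/eqP yz] := eqVneq y z.
  by rewrite -scalerDl subrKC scale1r.
by apply: interior_subset; apply: sA => //; exact: subset_closure.
Qed.

Section ApolloniusBall.
Context {R : realType} {n : nat} (x : 'rV[R]_n).
Implicit Types (y z v : 'rV[R]_n) (c t : R).

Lemma open_apollonius_ball c : open (apollonius_ball x c).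
Proof. by apply: openI; exact: open_apollonius_lt. Qed.

Lemma closure_apollonius_ball c : closure (apollonius_ball x c) `<=`
  [set y | apollonius x 0 y <= c ^+ 2 * sqnorm x] `&`
  [set y | apollonius x (c ^+ 2) y <= 0].
Proof.
set B := _ `&` _; have cB : closed B.
  by apply: closedI; exact: closed_apollonius_le.
rewrite (proj1 (closure_id B) cB); apply: closureS => y /= [y1 y2].
by split; exact: ltW.
Qed.

Lemma convex_apollonius_ball c : 0 <= c <= 1 ->
  convex_set (apollonius_ball x c).
Proof.
move=> /andP[c0 c1]; apply/convex_setP => y z t /= [y1 y2] [z1 z2] t01.
split; apply: apollonius_conv_lt => //.
by rewrite exprn_ile1.
Qed.

Lemma strictly_convex_apollonius_ball c : 0 <= c < 1 ->
  strictly_convex_set (apollonius_ball x c).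
Proof.
move=> /andP[c0 c1] y z /closure_apollonius_ball[y1 y2].
move=> /closure_apollonius_ball[z1 z2] yz t t01.
rewrite (proj1 (interior_id _) (open_apollonius_ball c)).
split; apply: apollonius_conv_lt_strict => //.
by rewrite expr_lt1.
Qed.

Context (n2 : (2 <= n)%N) (x0 : x <> 0).

(** The apex divides the segment from the origin to [x] in the ratio [1 : c], so
    it is on the Apollonius sphere. *)
Lemma apex_notin c : 0 <= c -> ~ apollonius_ball x c ((c + 1)^-1 *: x).
Proof.
move=> c0 [_ /=]; rewrite /apollonius -{1}(scale1r x) -scalerBl !sqnormZ.
set d := (c + 1)^-1; have -> : 1 - d = c * d by rewrite /d; field; lra.
by rewrite exprMn mulrA subrr ltxx.
Qed.

Lemma apollonius_orthogonal v :
  (forall s t, sqnorm (s *: x + t *: v) =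
     s ^+ 2 * sqnorm x + t ^+ 2 * sqnorm v) ->
  forall k a s, apollonius x k (a *: x + s *: v) =
    (1 - a) ^+ 2 * sqnorm x + s ^+ 2 * sqnorm v
      - k * (a ^+ 2 * sqnorm x + s ^+ 2 * sqnorm v).
Proof.
move=> orth k a s; rewrite /apollonius orth.
have -> : x - (a *: x + s *: v) = (1 - a) *: x + (- s) *: v.
  by apply/rowP => i; rewrite !mxE; ring.
by rewrite orth sqrrN.
Qed.

Lemma midpoint_symmetric y v :
  2^-1 *: (y + 2^-1 *: v) + (1 - 2^-1) *: (y + (- 2^-1) *: v) = y.
Proof. by apply/rowP => i; rewrite !mxE; field. Qed.

(** Moving by [s *: v] off the apex, orthogonally to [x], adds
    [(1 - c ^+ 2) * s ^+ 2 * sqnorm v] to the Apollonius function, which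
    vanishes there; for [1 < c] both directions therefore lead into the ball. *)
Lemma not_convex_apollonius_ball c : 1 < c ->
  ~ convex_set (apollonius_ball x c).
Proof.
move=> c1 /convex_setP cvx.
have X0 := sqnorm_gt0 _ x0.
have [v [v0 vx orth]] := exists_orthogonal _ n2 x0.
set a := (c + 1)^-1.
have a0 : 0 < a by rewrite invr_gt0; lra.
have aE : 1 - a = c * a by rewrite /a; field; lra.
(* The factor s with s^2 = 1/4 keeps the endpoints in the round ball for every
   c > 1: since a < 1/2, c^2 a^2 |x|^2 + |v|^2 / 4 < (c^2 + 1) |x|^2 / 4. *)
have side s : s ^+ 2 = 4^-1 -> apollonius_ball x c (a *: x + s *: v).
  move=> s2; split; rewrite /= (apollonius_orthogonal _ orth) s2 aE.
    have a2 : a <= 2^-1 by rewrite /a invf_ple ?posrE; lra.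
    have aa : a ^+ 2 <= 4^-1 by nra.
    have cX : sqnorm x <= c ^+ 2 * sqnorm x.
      by rewrite ler_peMl ?exprn_ege1 ?ltW.
    have caX : c ^+ 2 * sqnorm x * a ^+ 2 <= c ^+ 2 * sqnorm x * 4^-1.
      by rewrite ler_wpM2l// mulr_ge0 ?sqr_ge0 ?ltW.
    lra.
  have cv : 0 < (c ^+ 2 - 1) * sqnorm v.
    by rewrite mulr_gt0// subr_gt0 exprn_egt1.
  lra.
apply: (apex_notin c); first lra.
rewrite -/a -(midpoint_symmetric (a *: x) v).
by apply: cvx; [apply: side | apply: side |]; lra.
Qed.

(** For [c = 1] the Apollonius sphere is the bisector of the origin and [x], and
    the segment of the previous argument lies inside it.  Its endpoints are in
    the closure because the bisector can be crossed towards [x]. *)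
Lemma not_strictly_convex_apollonius_ball1 :
  ~ strictly_convex_set (apollonius_ball x 1).
Proof.
move=> scvx.
have X0 := sqnorm_gt0 _ x0.
have [v [v0 vx orth]] := exists_orthogonal _ n2 x0.
have side s : s ^+ 2 = 4^-1 ->
    closure (apollonius_ball x 1) ((1 + 1)^-1 *: x + s *: v).
  move=> s2 U; set h := (1 + 1)^-1 => Uy.
  have h2 : h = 2^-1 by [].
  have near_h : \forall a \near h^'+, U (a *: x + s *: v).
    apply: cvg_at_right_filter Uy.
    apply: cvgD; last exact: cvg_cst.
    by apply: cvgZr_tmp; exact: cvg_id.
  have : \forall a \near h^'+, (apollonius_ball x 1 `&` U) (a *: x + s *: v).
    near=> a.
    have ha : h < a by near: a; exact: nbhs_right_gt.
    have a1 : a < 1 by near: a; apply: nbhs_right_lt; rewrite h2; lra.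
    split; last by near: a.
    split; rewrite /= (apollonius_orthogonal _ orth) s2.
      have aa : (1 - a) ^+ 2 <= 4^-1 by rewrite h2 in ha; nra.
      have aX : (1 - a) ^+ 2 * sqnorm x <= 4^-1 * sqnorm x.
        by rewrite ler_wpM2r// ltW.
      lra.
    have aX : 0 < (2 * a - 1) * sqnorm x.
      by rewrite mulr_gt0//; rewrite h2 in ha; lra.
    lra.
  by move=> /filter_ex[a Ha]; exists (a *: x + s *: v).
apply: (apex_notin 1); first exact: ler01.
rewrite -(midpoint_symmetric ((1 + 1)^-1 *: x) v); apply: interior_subset.
apply: scvx; [by apply: side; lra | by apply: side; lra | | lra].
move=> /addrI vv; move: v0; rewrite (_ : v = 0).
  by rewrite /sqnorm big1 ?ltxx// => i _; rewrite mxE expr0n.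
by apply/rowP => i; move/rowP/(_ i): vv; rewrite !mxE; lra.
Unshelve. all: by end_near.
Qed.

End ApolloniusBall.

Theorem theorem3p1 (R : realType) (n : nat) (hn : (2 <= n)%N)
    (x : 'rV[R]_n) (hx : punctured_space R n x) (M : R) (hM : 0 < M) :
  (convex_set (jball (punctured_space R n) x M) <-> M \in `]0, ln 2])
  /\
  (strictly_convex_set (jball (punctured_space R n) x M) <-> M \in `]0, ln 2[).
Proof.
rewrite jball_apollonius ?(ltnW hn)//; set c := expR M - 1.
have c0 : 0 <= c by rewrite subr_ge0 ltW ?expR_gt1.
have leE : (M \in `]0, ln 2]) = (c <= 1).
  by rewrite in_itv /= hM -ler_expR lnK ?posrE// lerBlDr.
have ltE : (M \in `]0, ln 2[) = (c < 1).
  by rewrite in_itv /= hM -ltr_expR lnK ?posrE// ltrBlDr.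
rewrite leE ltE; split; split.
- move=> cvx; rewrite leNgt; apply/negP.
  by move=> /(not_convex_apollonius_ball _ hn hx).
- by move=> c1; apply: convex_apollonius_ball; rewrite c0.
- move=> scvx; rewrite lt_neqAle; apply/andP; split.
    by apply/eqP => c1; move: scvx; rewrite c1;
      exact: not_strictly_convex_apollonius_ball1.
  rewrite leNgt; apply/negP => /(not_convex_apollonius_ball _ hn hx); apply.
  exact: strictly_convex_convex.
- by move=> c1; apply: strictly_convex_apollonius_ball; rewrite c0.
Qed.
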